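(* Let $r\ge 2$ and $m\ge 1$. A balanced $r$-color urn model with multiple drawings consisting of unordered samples of size $m$, with ball replacement matrix $M=(\mathbf{a}_{\mathbf{k}})_{\mathbf{k}\in\Delta}$, is for both sampling schemes, model $\mathcal{M}$ (without replacement) and model $\mathcal{R}$ (with replacement), linear if and only if the vectors $\mathbf{a}_{\mathbf{k}}$ are given by the following affine combinations of the vectors $\mathbf{a}_{m\cdot\mathbf{e}_i}$: \[ \mathbf{a}_{\mathbf{k}}=\sum_{i=1}^{r}\frac{k_i}{m}\,\mathbf{a}_{m\cdot\mathbf{e}_i}\qquad\text{for all }\mathbf{k}=(k_1,\dots,k_r)\in\Delta . \] The conditional expected value is then given, for $n\ge 1$, by \[ \mathbb{E}[\mathbf{X}_n\mid\mathcal{F}_{n-1}]=\mathbf{X}_{n-1}\cdot\Big(I+\frac{1}{T_{n-1}}\cdot A\Big), \] where $I$ is the $r\times r$ identity matrix and $A=(\mathbf{a}_{m\cdot\mathbf{e}_i})_{1\le i\le r}$ is the reduced $r\times r$ ball replacement matrix, i.e. the matrix whose $i$-th row is $\mathbf{a}_{m\cdot\mathbf{e}_i}$.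
   Context: Vectors are row vectors; $\mathbf{e}_i$ is the $i$-th unit vector of $\mathbb{R}^r$. Let $\Delta=\{\mathbf{k}=(k_1,\dots,k_r)\in\mathbb{Z}^r : k_i\ge 0,\ \sum_{i=1}^r k_i=m\}$. Write $x^{\underline{k}}=x(x-1)\cdots(x-k+1)$ and $\binom{m}{\mathbf{k}}=\frac{m!}{k_1!\cdots k_r!}$; also $0^0=1$. Urn model (unordered samples). The urn contains balls of $r$ colors. The composition after $n$ draws is the random vector $\mathbf{X}_n=(X_n^{(1)},\dots,X_n^{(r)})$, where $X_n^{(i)}$ is the number of balls of color $i$; the initial composition $\mathbf{X}_0$ is a given non-random vector of nonnegative integers, and $T_n=\sum_{i=1}^r X_n^{(i)}$. At each step $n\ge 1$ a sample of $m$ balls is drawn, its colors are observed, the sample is returned to the urn, and if the sample contained exactly $k_i$ balls of color $i$ ($1\le i\le r$), then the vector $\mathbf{a}_{\mathbf{k}}\in\mathbb{Z}^r$ with index $\mathbf{k}=(k_1,\dots,k_r)\in\Delta$ is added to the composition: $\mathbf{X}_n=\mathbf{X}_{n-1}+\mathbf{a}_{\mathbf{k}}$. The ball replacement matrix $M=(\mathbf{a}_{\mathbf{k}})_{\mathbf{k}\in\Delta}$ has the vectors $\mathbf{a}_{\mathbf{k}}$ as rows. $\mathcal{F}_n$ is the sigma-algebra generated by the first $n$ draws. Conditionally on $\mathcal{F}_{n-1}$, the probability that the $n$-th sample has color counts $\mathbf{k}$ is: - model $\mathcal{M}$ (without replacement): $\binom{m}{\mathbf{k}}\prod_{i=1}^r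 (X_{n-1}^{(i)})^{\underline{k_i}}\big/ (T_{n-1})^{\underline{m}}$; - model $\mathcal{R}$ (with replacement): $\binom{m}{\mathbf{k}}\prod_{i=1}^r (X_{n-1}^{(i)})^{k_i}\big/ (T_{n-1})^{m}$. Balanced: there is a constant integer $\sigma>0$ (the total balance) such that for every $\mathbf{k}\in\Delta$ the entries of $\mathbf{a}_{\mathbf{k}}$ sum to $\sigma$. Hence $T_n=n\sigma+T_0$ is deterministic. Tenability (standing assumption). Writing $\mathbf{a}_{\mathbf{k}}=(a_1,\dots,a_r)$: for model $\mathcal{M}$, $a_i\ge -k_i$ for all $i$ and all $\mathbf{k}\in\Delta$; for model $\mathcal{R}$, $a_i\ge -1$ if $k_i>0$ and $a_i\ge 0$ if $k_i=0$. The initial total satisfies $T_0\ge m$ for model $\mathcal{M}$ and $T_0\ge 1$ for model $\mathcal{R}$, so that sampling is possible. Linear: an $r$-color urn model with multiple drawings and sample size $m\ge 1$ is called linear if the random vector $\mathbf{X}_n=(X_n^{(1)},\dots,X_n^{(r)})$, specifying the composition of the urn after $n$ draws, satisfies $\mathbb{E}[\mathbf{X}_n\mid\mathcal{F}_{n-1}]=\mathbf{X}_{n-1}\cdot C_n$ for certain matrices $(C_k)_{k\in\mathbb{N}}$ in $\mathbb{R}^{r\times r}$.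
   Formalization: ''Linear'' is required for every admissible initial composition X_0, with matrices C_n depending on X_0 only through T_0; for one fixed X_0 (e.g. an urn with only one color that stays so) ''linear implies affine'' is false. *)

(* Defs.v *)
From HB Require Import structures.
From mathcomp Require Import all_boot all_order all_algebra.
From mathcomp Require Import all_classical all_reals all_analysis.

Set Implicit Arguments.
Unset Strict Implicit.
Unset Printing Implicit Defensive.

Import Order.TTheory GRing.Theory Num.Theory.

Local Open Scope classical_set_scope.
Local Open Scope ring_scope.

(* Color counts of a sample of size m. Bounding each count by m costs nothing
   and makes the type finite. *)
Definition Delta (r m : nat) : finType :=
  {k : {ffun 'I_r -> 'I_m.+1} | (\sum_(i < r) k i == m)%N}.

Definition cnt (r m : nat) (k : Delta r m) (i : 'I_r) : nat := val k i.

Lemma vertex_subproof (r m : nat) (i : 'I_r) :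
  (\sum_(j < r)
     [ffun j' => if j' == i then @ord_max m else @ord0 m] j == m)%N.
Proof.
rewrite (bigD1 i) //= ffunE eqxx big1 ?addn0 //= => j /negbTE ji.
by rewrite ffunE ji.
Qed.

(* The index m * e_i. *)
Definition vertex (r m : nat) (i : 'I_r) : Delta r m :=
  exist _ [ffun j => if j == i then @ord_max m else @ord0 m]
    (vertex_subproof m i).

Inductive sampling := without_replacement | with_replacement.

Definition falling (R : realType) (x : R) (k : nat) : R :=
  \prod_(j < k) (x - j%:R).

Definition multinomial (R : realType) (r m : nat) (k : Delta r m) : R :=
  m`!%:R / \prod_(i < r) (cnt k i)`!%:R.

Definition total (r : nat) (x : 'rV[int]_r) : int := \sum_(i < r) x 0 i.

Definition sample_power (R : realType) (s : sampling) : R -> nat -> R :=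
  match s with
  | without_replacement => @falling R
  | with_replacement => fun x k => x ^+ k
  end.

(* Probability of drawing color counts k from composition x. *)
Definition sample_prob (R : realType) (r m : nat) (s : sampling)
    (x : 'rV[int]_r) (k : Delta r m) : R :=
  multinomial R k * \prod_(i < r) sample_power s (x 0 i)%:~R (cnt k i)
    / sample_power s (total x)%:~R m.

(* A replacement rule a : Delta r m -> 'rV[int]_r is the family of the rows
   a_k of the ball replacement matrix. *)
Definition balanced (r m : nat) (a : Delta r m -> 'rV[int]_r) (sigma : int) :=
  forall k, total (a k) = sigma.

Definition tenable (r m : nat) (s : sampling) (a : Delta r m -> 'rV[int]_r) :=
  forall k i,
    match s return Prop with
    | without_replacement => - (cnt k i)%:Z <= a k 0 i
    | with_replacement =>
        ((0 < cnt k i)%N -> -1 <= a k 0 i) /\ (cnt k i = 0%N -> 0 <= a k 0 i)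
    end.

Definition initial_total (r : nat) (x0 : 'rV[nat]_r) : nat :=
  (\sum_(i < r) x0 0%R i)%N.

Definition admissible (r m : nat) (s : sampling) (x0 : 'rV[nat]_r) : bool :=
  match s with
  | without_replacement => (m <= initial_total x0)%N
  | with_replacement => (1 <= initial_total x0)%N
  end.

(* Z is a version of the conditional expectation E[Y | G], where the
   sigma-algebra G is given by its set of events. *)
Definition is_condexp (R : realType) (d : measure_display)
    (T : measurableType d) (P : probability T R) (G : set (set T))
    (Y Z : T -> R) : Prop :=
  [/\ P.-integrable setT (EFin \o Y),
      P.-integrable setT (EFin \o Z),
      forall B : set R, measurable B -> G (Z @^-1` B) &
      forall A, G A ->
        (\int[P]_(x in A) (Z x)%:E = \int[P]_(x in A) (Y x)%:E)%E].

Definition is_condexp_row (R : realType) (d : measure_display)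
    (T : measurableType d) (P : probability T R) (G : set (set T)) (r : nat)
    (Y Z : T -> 'rV[R]_r) : Prop :=
  forall j, is_condexp P G (fun w => Y w 0 j) (fun w => Z w 0 j).

(* The n-th draw of the urn is draw n.-1: draws are indexed from 0. *)
Fixpoint composition (r m : nat) (T : Type) (a : Delta r m -> 'rV[int]_r)
    (x0 : 'rV[nat]_r) (draw : nat -> T -> Delta r m) (n : nat) (w : T) :
    'rV[int]_r :=
  if n is n'.+1 then composition a x0 draw n' w + a (draw n' w)
  else map_mx Posz x0.

(* Events generated by the first n draws. *)
Definition draw_algebra (r m : nat) (T : Type) (draw : nat -> T -> Delta r m)
    (n : nat) : set (set T) :=
  <<s [set A | exists i k, (i < n)%N /\ A = draw i @^-1` [set k]] >>.

(* A realization of the urn started from x0, on its own probability space;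
   conditional probabilities are conditional expectations of indicators. *)
Record urn_process (R : realType) (r m : nat) (s : sampling)
    (a : Delta r m -> 'rV[int]_r) (x0 : 'rV[nat]_r) := UrnProcess {
  urn_display : measure_display;
  urn_space : measurableType urn_display;
  urn_law : probability urn_space R;
  urn_draw : nat -> urn_space -> Delta r m;
  urn_draw_measurable : forall n k, measurable (urn_draw n @^-1` [set k]);
  urn_draw_law : forall n k,
    is_condexp urn_law (draw_algebra urn_draw n)
      \1_(urn_draw n @^-1` [set k])
      (fun w => sample_prob R s (composition a x0 urn_draw n w) k)
}.

Definition urnX (R : realType) (r m : nat) (s : sampling)
    (a : Delta r m -> 'rV[int]_r) (x0 : 'rV[nat]_r)
    (U : urn_process R s a x0) (n : nat) : urn_space U -> 'rV[R]_r :=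
  fun w => map_mx intr (composition a x0 (@urn_draw R r m s a x0 U) n w).

Definition urnF (R : realType) (r m : nat) (s : sampling)
    (a : Delta r m -> 'rV[int]_r) (x0 : 'rV[nat]_r)
    (U : urn_process R s a x0) (n : nat) : set (set (urn_space U)) :=
  draw_algebra (@urn_draw R r m s a x0 U) n.

Arguments urnX {R r m s a x0} U n w.
Arguments urnF {R r m s a x0} U n.

Definition urnT (R : realType) (r m : nat) (s : sampling)
    (a : Delta r m -> 'rV[int]_r) (x0 : 'rV[nat]_r)
    (U : urn_process R s a x0) (n : nat) (w : urn_space U) : R :=
  \sum_(i < r) urnX U n w 0 i.

Arguments urnT {R r m s a x0} U n w.

(* Linearity is a property of the urn model, i.e. of the sampling scheme and
   the replacement rule, hence the quantification over initial compositions x0.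
   C_n may depend on x0 only through T_0 (as in C_n = I + A / T_{n-1}).
   Other quantifications make "linear -> affine" false:
   - single x0: an urn that never leaves one color is linear whatever the rows
     a_k at mixed samples k are;
   - all x0, but C_n varying with x0: for r = 3, m = 2, a_(0,0,2) = (2,0,1) and
     a_k = (1,1,1) for the other k, the third color evolves deterministically,
     so E[X_n - X_{n-1} | F_{n-1}] and T_{n-1} are deterministic;
   - a single T_0, with replacement: for T_0 = 1, r = m = 2,
     a_(2,0) = (sigma,0), a_(0,2) = (0,sigma), only one color is ever drawn. *)
Definition linear_urn (R : realType) (r m : nat) (s : sampling)
    (a : Delta r m -> 'rV[int]_r)
    (U : forall x0, admissible m s x0 -> urn_process R s a x0) : Prop :=
  forall T0 : nat, exists C : nat -> 'M[R]_r,
  forall (x0 : 'rV[nat]_r) (hx0 : admissible m s x0),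
    initial_total x0 = T0 ->
  forall n : nat, (1 <= n)%N ->
    is_condexp_row (urn_law (U x0 hx0)) (urnF (U x0 hx0) n.-1)
      (urnX (U x0 hx0) n) (fun w => urnX (U x0 hx0) n.-1 w *m C n).

Definition real_row (R : realType) (r m : nat) (a : Delta r m -> 'rV[int]_r)
    (k : Delta r m) : 'rV[R]_r := map_mx intr (a k).

Definition affine_rule (R : realType) (r m : nat)
    (a : Delta r m -> 'rV[int]_r) : Prop :=
  forall k, real_row R a k =
    \sum_(i < r) ((cnt k i)%:R / m%:R) *: real_row R a (vertex m i).

Definition reduced_matrix (R : realType) (r m : nat)
    (a : Delta r m -> 'rV[int]_r) : 'M[R]_r :=
  \matrix_(i < r) real_row R a (vertex m i).

(* Main.v *)
(* With b_k the deviation of a_k from its affine interpolation, the mean of the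
   color counts of a sample drawn from x is m x / T, so the conditional drift
   sum_k p(x, k) a_k equals x A / T + sum_k p(x, k) b_k. The second sum vanishes
   when the rule is affine. Conversely, a drift x B that is linear in x on all x
   with the given total T forces A = T B (take x = T e_i), hence
   sum_k p(x, k) b_k = 0 for every initial composition x, and the coefficients
   p(., k) are linearly independent: only the first draw is needed. *)

Require Import Defs.
From HB Require Import structures.
From mathcomp Require Import all_boot all_order all_algebra.
From mathcomp Require Import all_classical all_reals all_analysis.
From mathcomp Require Import ring.

Import Order.TTheory GRing.Theory Num.Theory.

Local Open Scope classical_set_scope.
Local Open Scope ring_scope.

(** * Generalized falling powers and Vandermonde convolution *)

(* Both schemes have sample_power s x k = x (x - h) ... (x - (k - 1) h), with
   h = 1 or h = 0. *)
Definition decrement (R : realType) (s : sampling) : R :=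
  if s is without_replacement then 1 else 0.

Lemma sample_power0 {R : realType} s (x : R) : sample_power s x 0 = 1.
Proof. by case: s; rewrite /= /falling ?big_ord0 ?expr0. Qed.

Lemma sample_powerSr {R : realType} s (x : R) k :
  sample_power s x k.+1 = sample_power s x k * (x - k%:R * decrement R s).
Proof.
by case: s; rewrite /= /falling ?big_ord_recr ?mulr1 ?mulr0 ?subr0 ?exprSr.
Qed.

Lemma sample_powerSl {R : realType} s (x : R) k :
  sample_power s x k.+1 = x * sample_power s (x - decrement R s) k.
Proof.
elim: k => [|k IHk]; first by rewrite sample_powerSr !sample_power0; ring.
by rewrite sample_powerSr IHk sample_powerSr -natr1; ring.
Qed.

Lemma sample_power_neq0 {R : realType} s (x : R) k :
  (forall j, (j < k)%N -> x != j%:R * decrement R s) -> sample_power s x k != 0.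
Proof.
elim: k => [|k IHk] xk; first by rewrite sample_power0 oner_neq0.
rewrite sample_powerSr mulf_neq0 ?subr_eq0 ?xk// IHk// => j jk.
by rewrite xk// ltnS ltnW.
Qed.

Lemma sample_power_nat_eq0 {R : realType} (n k : nat) :
  (n < k)%N -> sample_power without_replacement (n%:R : R) k = 0.
Proof.
by move=> nk; rewrite /= /falling (bigD1 (Ordinal nk))//= subrr mul0r.
Qed.

Lemma sample_power_total_neq0 {R : realType} m s (t : nat) :
  (0 < t)%N -> (if s is without_replacement then m <= t else true)%N ->
  sample_power s (t%:R : R) m != 0.
Proof.
move=> t0 mt; apply: sample_power_neq0 => j jm.
case: s mt => /= mt; last by rewrite mulr0 pnatr_eq0 -lt0n.
by rewrite mulr1 eqr_nat gtn_eqF// (leq_trans jm).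
Qed.

(** The binomial coefficient [x] over [k] without replacement, the exponential series term with
    replacement. Dividing by the factorial absorbs the multinomial coefficient. *)
Definition divided_power {R : realType} (s : sampling) (x : R) (k : nat) : R :=
  sample_power s x k / k`!%:R.

Lemma factr_neq0 {R : realType} k : k`!%:R != 0 :> R.
Proof. by rewrite pnatr_eq0 -lt0n fact_gt0. Qed.

Lemma divided_powerSr {R : realType} s (x : R) k :
  k.+1%:R * divided_power s x k.+1 =
  (x - k%:R * decrement R s) * divided_power s x k.
Proof.
rewrite /divided_power sample_powerSr factS natrM; field.
by rewrite factr_neq0 [1 + _]addrC natr1 pnatr_eq0.
Qed.

Lemma divided_powerSl {R : realType} s (x : R) k :
  k.+1%:R * divided_power s x k.+1 = x * divided_power s (x - decrement R s) k.
Proof.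
rewrite /divided_power sample_powerSl factS natrM; field.
by rewrite factr_neq0 [1 + _]addrC natr1 pnatr_eq0.
Qed.

(** Vandermonde's identity, or the binomial theorem when the decrement [h] is 0. In the induction
    the factors [x - k h] and [y - (n - k) h] add up to [x + y - n h], as the recurrence
    requires. *)
Lemma divided_powerD {R : realType} s (x y : R) n :
  \sum_(k < n.+1) divided_power s x k * divided_power s y (n - k) =
  divided_power s (x + y) n.
Proof.
elim: n => [|n IHn].
  by rewrite big_ord1 /divided_power !sample_power0 fact0; field.
have n0 : n.+1%:R != 0 :> R by rewrite pnatr_eq0.
apply: (mulfI n0); rewrite divided_powerSr -IHn !mulr_sumr.
set c := divided_power s.
(* The weight [n.+1] is split as [k + (n.+1 - k)], so that each half lowers one of the two
   indices. *)
transitivity (\sum_(k < n.+2) (k%:R * c x k * c y (n.+1 - k)%N) +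
    \sum_(k < n.+2) ((n.+1 - k)%:R * c y (n.+1 - k)%N * c x k)).
  rewrite -big_split; apply: eq_bigr => k _ /=.
  by rewrite natrB -1?ltnS//; ring.
(* The terms of weight zero drop out: [k = 0] in the first sum, [k = n.+1] in the second. *)
rewrite big_ord_recl [X in _ + X]big_ord_recr /= subnn !mul0r add0r addr0.
rewrite -big_split; apply: eq_bigr => k _ /=; rewrite /bump leq0n add1n subSS.
rewrite divided_powerSr subSn -1?ltnS// divided_powerSr -/c natrB -1?ltnS//.
by ring.
Qed.

(** The mean count of one color against the rest: [divided_powerSl] absorbs [k], Vandermonde is
    applied at [x - h], and the factor [x + y] folds the shifted power back. *)
Lemma weighted_divided_powerD {R : realType} s (x y : R) n :
  (x + y) *
    \sum_(k < n.+1) k%:R * divided_power s x k * divided_power s y (n - k) =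
  n%:R * x * divided_power s (x + y) n.
Proof.
case: n => [|n]; first by rewrite big_ord1 !mul0r mulr0.
rewrite big_ord_recl !mul0r add0r.
under eq_bigr => k _ do rewrite lift0 divided_powerSl subSS -mulrA.
rewrite -mulr_sumr divided_powerD mulrAC divided_powerSl.
by rewrite [x - _ + y]addrAC; ring.
Qed.

(** * Generating functions over color counts and the mean of a sample *)

Section compositions.
Context {R : realType} {r m : nat}.

(** Expanding the product chooses one exponent per color, and the coefficient of ['X^m] retains the
    choices that sum to [m]. *)
Lemma sum_Delta_coef (f : 'I_r -> nat -> R) :
  \sum_(k : Delta r m) \prod_i f i (cnt k i) =
  (\prod_i \poly_(e < m.+1) f i e)`_m.
Proof.
under [in RHS]eq_bigr => i _ do rewrite poly_def.
rewrite bigA_distr_bigA/= coef_sum.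
rewrite (eq_bigr (fun g : {ffun 'I_r -> 'I_m.+1} =>
    if (\sum_i g i == m)%N then \prod_i f i (g i) else 0)); last first.
  move=> g _.
  rewrite (eq_bigr (fun i => (f i (g i))%:P * 'X^(g i))); last first.
    by move=> i _; rewrite mul_polyC.
  rewrite big_split/= -rmorph_prod mul_polyC coefZ.
  rewrite -(big_morph _ (exprD 'X) (expr0 'X)) coefXn eq_sym.
  by case: ifP; rewrite ?mulr1 ?mulr0.
rewrite -big_mkcond/= [RHS](@reindex_omap _ _ _ _ (Delta r m) val insub); last first.
  by move=> g gm; rewrite insubT.
apply: eq_big => [k|k _]; last by [].
by rewrite (valP k) valK eqxx.
Qed.

(** Vandermonde merges the colors in [P] into a single one; cutting the series at [m] leaves the
    coefficients up to [m] intact. *)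
Lemma coef_prod_divided_power s (x : 'I_r -> R) (P : pred 'I_r) n :
  (n <= m)%N ->
  (\prod_(i | P i) \poly_(e < m.+1) divided_power s (x i) e)`_n =
  divided_power s (\sum_(i | P i) x i) n.
Proof.
elim/big_rec2: _ n => [|i t p _ IHp] n nm.
  rewrite coef1; case: n nm => [|n] _ /=.
    by rewrite /divided_power sample_power0 fact0 divr1.
  by rewrite /divided_power sample_powerSl !mul0r.
rewrite coefM -divided_powerD; apply: eq_bigr => e _.
rewrite coef_poly ltnS (leq_trans _ nm) -1?ltnS// IHp//.
by rewrite (leq_trans (leq_subr _ _)).
Qed.

Lemma sample_probE s (x : 'rV[int]_r) (k : Delta r m) :
  sample_prob R s x k =
  \prod_i divided_power s (x 0 i)%:~R (cnt k i) /
  divided_power s (Defs.total x)%:~R m.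
Proof.
rewrite /sample_prob /multinomial /divided_power big_split/= prodfV invfM invrK.
by ring.
Qed.

Lemma mean_count s (x : 'rV[int]_r) (j : 'I_r) :
  (Defs.total x)%:~R != 0 :> R ->
  sample_power s ((Defs.total x)%:~R : R) m != 0 ->
  \sum_(k : Delta r m) sample_prob R s x k * (cnt k j)%:R =
  m%:R * (x 0 j)%:~R / (Defs.total x)%:~R.
Proof.
move=> T0 Tm.
have d0 : divided_power s ((Defs.total x)%:~R : R) m != 0.
  by rewrite mulf_neq0// invr_neq0// factr_neq0.
(* The weight [cnt k j] goes into the factor of color [j], so the summand stays a product over
   colors. *)
pose f i e : R := (if i == j then e%:R else 1) * divided_power s (x 0 i)%:~R e.
rewrite (eq_bigr (fun k => \prod_i f i (cnt k i) /
    divided_power s (Defs.total x)%:~R m)); last first.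
  move=> k _; rewrite sample_probE (bigD1 j)//= [in RHS](bigD1 j)//= /f eqxx.
  rewrite [in RHS](eq_bigr (fun i => divided_power s (x 0 i)%:~R (cnt k i))).
    by ring.
  by move=> i /negbTE ->; rewrite mul1r.
rewrite -mulr_suml sum_Delta_coef (bigD1 j)//= (eq_bigr
  (fun i => \poly_(e < m.+1) divided_power s ((x 0 i)%:~R : R) e)); last first.
  by move=> i /negbTE ij; apply/polyP => e; rewrite !coef_poly /f ij mul1r.
have TE : (Defs.total x)%:~R = (x 0 j)%:~R + \sum_(i | i != j) (x 0 i)%:~R :> R.
  by rewrite /Defs.total rmorph_sum (bigD1 j).
apply: (mulfI T0); rewrite [RHS]mulrCA divff// mulr1 mulrA.
apply/(canLR (mulfK d0)).
(* The colors other than [j] merge into one, which leaves the two-color mean. *)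
rewrite coefM [X in _ * divided_power _ X _]TE -weighted_divided_powerD -TE.
congr (_ * _).
apply: eq_bigr => e _; rewrite coef_poly ltn_ord coef_prod_divided_power ?leq_subr//.
by rewrite /f eqxx.
Qed.

End compositions.

(** * Integrals, events and bounds for the composition *)

Lemma integral_linear_combination {R : realType} {d} {T : measurableType d}
    (P : probability T R) (I : finType) (A : set T) (f : T -> R)
    (g : I -> T -> R) (c : I -> R) : measurable A ->
  P.-integrable setT (EFin \o f) ->
  (forall i, P.-integrable setT (EFin \o g i)) ->
  (\int[P]_(w in A) (f w + \sum_i g i w * c i)%:E =
   \int[P]_(w in A) (f w)%:E + \sum_i (\int[P]_(w in A) (g i w)%:E) * (c i)%:E)%E.
Proof.
move=> mA intf intg.
have AT g0 : P.-integrable setT (EFin \o g0) -> P.-integrable A (EFin \o g0).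
  exact: integrableS.
have intgc i : P.-integrable A (fun w => (g i w)%:E * (c i)%:E)%E.
  by apply: integrableZr => //; exact: AT.
under eq_integral => w _.
  rewrite EFinD -sumEFin; under eq_bigr => i _ do rewrite EFinM.
  over.
rewrite integralD//; [|exact: AT|exact: integrable_sum].
rewrite integral_sum//; congr (_ + _)%E.
by apply: eq_bigr => i _; rewrite integralZr//; exact: AT.
Qed.

Lemma draw_algebra_sub_sigma {r m : nat} {T : Type}
    (draw : nat -> T -> Delta r m) (n p : nat) : (n <= p)%N -> draw_algebra draw n `<=` draw_algebra draw p.
Proof.
move=> np; apply: sub_sigma_algebra2 => _ [i [k [ltin ->]]].
by exists i, k; split => //; exact: leq_trans np.
Qed.

(** Splitting on the last draw makes the event a finite union over [k]; [S] is generalized because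
    each piece shifts it by [a k]. *)
Lemma draw_algebra_composition {r m : nat} {T : pointedType}
    (a : Delta r m -> 'rV[int]_r)
    x0 (draw : nat -> T -> Delta r m) n (S : set 'rV[int]_r) :
  draw_algebra draw n (composition a x0 draw n @^-1` S).
Proof.
elim: n S => [|n IHn] S.
  (* With no draw the composition is constant, so the preimage is everything or nothing. *)
  have [xS|xS] := pselect (S (map_mx Posz x0)).
    rewrite (_ : _ @^-1` _ = setT); last by apply/seteqP; split.
    rewrite -(setD0 setT); apply: sigma_algebraCD; exact: sigma_algebra0.
  rewrite (_ : _ @^-1` _ = set0); first exact: sigma_algebra0.
  by apply/seteqP; split.
set G := [set A | exists i k, (i < n.+1)%N /\ A = draw i @^-1` [set k]].
rewrite (_ : _ @^-1` _ = \bigcup_(k in [set: Delta r m])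
    (draw n @^-1` [set k] `&`
    composition a x0 draw n @^-1` [set x | S (x + a k)])); last first.
  apply/seteqP; split => [w Sw|w [k _ [<-]]]//.
  by exists (draw n w).
apply: (@fin_bigcup_measurable _ (g_sigma_algebraType G)) => // k _.
apply: (@measurableI _ (g_sigma_algebraType G)).
  by apply: sub_sigma_algebra; exists n, k.
exact: (@draw_algebra_sub_sigma _ _ _ _ _ _ (leqnSn n)).
Qed.

(** Only finitely many compositions are possible after [n] draws; the induction passes from [f] to
    its shifts by [a k]. *)
Lemma composition_bounded {R : realType} {r m : nat} {T : Type}
    (a : Delta r m -> 'rV[int]_r) x0 (draw : nat -> T -> Delta r m) n
    (f : 'rV[int]_r -> R) :
  exists M, forall w, `|f (composition a x0 draw n w)| <= M.
Proof.
elim: n f => [|n IHn] f; first by exists `|f (map_mx Posz x0)|.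
have [M fM] := choice (fun k => IHn (fun x => f (x + a k))).
(* Each [M k] bounds an absolute value, hence is nonnegative, so the sum dominates every one of
   them. *)
exists (\sum_k M k) => w; apply: (le_trans (fM (draw n w) w)).
by rewrite (bigD1 (draw n w))//= lerDl sumr_ge0// => k _; exact: le_trans (fM k w).
Qed.

Lemma total_Posz {r : nat} (x : 'rV[nat]_r) :
  Defs.total (map_mx Posz x) = (initial_total x)%:Z.
Proof.
rewrite /Defs.total /initial_total -[RHS]natz natr_sum.
by apply: eq_bigr => i _; rewrite mxE natz.
Qed.

Lemma total_composition {r m : nat} {T : Type} {a : Delta r m -> 'rV[int]_r}
    {sigma : int} x0 (draw : nat -> T -> Delta r m) n w : balanced a sigma ->
  Defs.total (composition a x0 draw n w) =
  (initial_total x0)%:Z + sigma *+ n.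
Proof.
move=> bal; elim: n => [|n IHn].
  by rewrite mulr0n addr0 total_Posz.
rewrite mulrS [sigma + _]addrC addrA -IHn -(bal (draw n w)) /Defs.total -big_split.
by apply: eq_bigr => i _; rewrite mxE.
Qed.

(** * Conditional expectation of the next composition *)

Section urn_process.
Context {R : realType} {r m : nat} {s : sampling} {a : Delta r m -> 'rV[int]_r}.
Context {x0 : 'rV[nat]_r} (U : urn_process R s a x0).
Let P := urn_law U.
Let X := composition a x0 (@urn_draw R r m s a x0 U).

Lemma urnF_measurable n A : urnF U n A -> measurable A.
Proof.
apply: smallest_sub; first exact: sigma_algebra_measurable.
by move=> _ [i [k [_ ->]]]; exact: urn_draw_measurable.
Qed.

Lemma integrable_composition n (f : 'rV[int]_r -> R) :
  P.-integrable setT (fun w => (f (X n w))%:E).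
Proof.
apply: (@measurable_bounded_integrable _ _ _ _ (f \o X n)) => //.
- exact: fin_num_fun_lty.
- move=> _ B mB; rewrite setTI; apply: (@urnF_measurable n).
  exact: (@draw_algebra_composition _ _ _ _ _ _ _ (f @^-1` B)).
- have [M fM] := composition_bounded a x0 (@urn_draw R r m s a x0 U) n f.
  exists M; split; first exact: num_real.
  by move=> N MN w _ /=; rewrite (le_trans (fM w))// ltW.
Qed.

(** The increment is the sum of the [a k] weighted by the indicators of the draw events, and
    [urn_draw_law] replaces each indicator by its sampling probability. *)
Lemma urn_condexp n :
  is_condexp_row P (urnF U n) (urnX U n.+1)
    (fun w => urnX U n w + \sum_k sample_prob R s (X n w) k *: real_row R a k).
Proof.
move=> j.
(* The candidate is a function of the present composition, whence its measurability and
   integrability. *)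
pose Z (x : 'rV[int]_r) : R :=
  (x 0 j)%:~R + \sum_k sample_prob R s x k * (a k 0 j)%:~R.
have ZE : (fun w => (urnX U n w + \sum_k sample_prob R s (X n w) k *:
    real_row R a k) 0 j) = Z \o X n.
  apply/funext => w; rewrite !mxE summxE; congr (_ + _).
  by apply: eq_bigr => k _; rewrite !mxE.
rewrite ZE; split.
- rewrite (_ : _ \o _ = fun w => ((X n.+1 w 0 j)%:~R : R)%:E).
    exact: (integrable_composition n.+1 (fun x => (x 0 j)%:~R)).
  by apply/funext => w; rewrite /= mxE.
- exact: integrable_composition.
- move=> B _; exact: (@draw_algebra_composition _ _ _ _ _ _ _ (Z @^-1` B)).
move=> A FA; have mA := urnF_measurable _ _ FA.
pose D k := @urn_draw R r m s a x0 U n @^-1` [set k].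
rewrite integral_linear_combination//; last first.
- by move=> k; exact: (integrable_composition n (fun x => sample_prob R s x k)).
- exact: (integrable_composition n (fun x => (x 0 j)%:~R)).
(* Exactly one indicator equals 1, that of the actual draw. *)
transitivity (\int[P]_(w in A) (((X n w 0 j)%:~R : R) +
    \sum_k \1_(D k) w * (a k 0 j)%:~R)%:E)%E; last first.
  apply: eq_integral => w _; congr EFin; rewrite !mxE rmorphD; congr (_ + _).
  rewrite (bigD1 (@urn_draw R r m s a x0 U n w))//= big1 ?addr0.
    by rewrite indicE mem_set// mul1r.
  move=> k kw; rewrite indicE memNset ?mul0r// => wk.
  by rewrite -wk eqxx in kw.
rewrite integral_linear_combination//; last first.
- by move=> k; apply: integrable_indic; exact: urn_draw_measurable.
- exact: (integrable_composition n (fun x => (x 0 j)%:~R)).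
congr (_ + _)%E; apply: eq_bigr => k _; congr (_ * _)%E.
by have [_ _ _ ->] := urn_draw_law U n k.
Qed.

End urn_process.

(** * Affine interpolation of the replacement rule *)

Section affine_interpolation.
Context {R : realType} {r m : nat} (a : Delta r m -> 'rV[int]_r).

Definition affine_interpolant (k : Delta r m) : 'rV[R]_r :=
  \sum_(i < r) ((cnt k i)%:R / m%:R) *: real_row R a (vertex m i).

Lemma affine_interpolant_vertex i : (0 < m)%N ->
  affine_interpolant (vertex m i) = real_row R a (vertex m i).
Proof.
move=> m0; rewrite /affine_interpolant (bigD1 i)//= big1 ?addr0.
  by rewrite /cnt /= ffunE eqxx divff ?scale1r// pnatr_eq0 -lt0n.
by move=> j /negbTE ji; rewrite /cnt /= ffunE ji mul0r scale0r.
Qed.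

(** The interpolant is linear in the counts, so only their means enter, and the [m] from
    [mean_count] cancels the weight [1 / m]. *)
Lemma affine_interpolant_mean s (x : 'rV[int]_r) : (0 < m)%N ->
  (Defs.total x)%:~R != 0 :> R ->
  sample_power s ((Defs.total x)%:~R : R) m != 0 ->
  \sum_k sample_prob R s x k *: affine_interpolant k =
  (Defs.total x)%:~R^-1 *: (map_mx intr x *m reduced_matrix R a).
Proof.
move=> m0 T0 Tm; have m0R : m%:R != 0 :> R by rewrite pnatr_eq0 -lt0n.
apply/rowP => j; rewrite summxE !mxE.
under eq_bigr => k _ do rewrite mxE summxE mulr_sumr.
rewrite exchange_big/= mulr_sumr; apply: eq_bigr => i _; rewrite !mxE.
under eq_bigr => k _ do rewrite !mxE !mulrA.
rewrite -!mulr_suml mean_count//; field.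
by rewrite m0R T0.
Qed.

End affine_interpolation.

(** * Linear independence of the sampling probabilities *)

Lemma cnt_inj {r m : nat} (k l : Delta r m) : cnt k =1 cnt l -> k = l.
Proof. by move=> kl; apply/val_inj/ffunP => i; exact/val_inj/kl. Qed.

Lemma sum_cnt {r m : nat} (k : Delta r m) : (\sum_i cnt k i)%N = m.
Proof. exact/eqP/(valP k). Qed.

(** Both families of counts sum to [m], so [l] below [k] everywhere would force equality. *)
Lemma exists_cnt_gt {r m : nat} (k l : Delta r m) :
  l != k -> exists i, (cnt k i < cnt l i)%N.
Proof.
move=> lk; apply/existsP; apply: contra_neqT lk => /existsPn lek.
have {}lek i : (cnt l i <= cnt k i)%N by rewrite leqNgt.
apply: cnt_inj => i; apply/eqP.
have := leqif_sum (fun i (_ : true) => leqif_eq (lek i)).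
by rewrite !sum_cnt => -[_]; rewrite eqxx => /esym/forallP/(_ i).
Qed.

Lemma multinomial_neq0 {R : realType} {r m : nat} (k : Delta r m) :
  multinomial R k != 0.
Proof.
rewrite mulf_neq0 ?factr_neq0// invr_neq0//.
by apply/prodf_neq0 => i _; exact: factr_neq0.
Qed.

(** Stated for all [n] from the initial total on, so as to cover the denominators after any number
    of draws. *)
Lemma admissible_total_neq0 {R : realType} {r m : nat} s (x0 : 'rV[nat]_r) n :
  (0 < m)%N -> admissible m s x0 -> (initial_total x0 <= n)%N ->
  n%:R != 0 :> R /\ sample_power s (n%:R : R) m != 0.
Proof.
move=> m0 adm xn.
have n0 : (0 < n)%N by apply: leq_trans xn; case: s adm => //=; exact: leq_trans.
split; first by rewrite pnatr_eq0 -lt0n.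
by apply: sample_power_total_neq0 => //; case: s adm => //= mx; exact: leq_trans xn.
Qed.

(* Taking x0 = k kills every term but the k-th one: the other l in Delta exceed
   k in some coordinate. *)
Lemma without_replacement_mean_eq0 {R : realType} {r m : nat}
    (b : Delta r m -> R) : (0 < m)%N ->
  (forall x0, admissible m without_replacement x0 ->
     \sum_k sample_prob R without_replacement (map_mx Posz x0) k * b k = 0) ->
  forall k, b k = 0.
Proof.
move=> m0 b0 k; pose x0 : 'rV[nat]_r := \row_i cnt k i.
have x0m : initial_total x0 = m.
  by rewrite -[RHS](sum_cnt k); apply: eq_bigr => i _; rewrite mxE.
have adm : admissible m without_replacement x0 by rewrite /= x0m.
have [_ Tm] := @admissible_total_neq0 R _ _ _ _ _ m0 adm (leqnn _).
have := b0 _ adm; rewrite (bigD1 k)//= big1 ?addr0; last first.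
  move=> l lk; have [i kl] := exists_cnt_gt _ _ lk.
  rewrite /sample_prob (bigD1 i)//= !mxE.
  have := @sample_power_nat_eq0 R _ _ kl; rewrite /= => ->.
  by rewrite mul0r mulr0 !mul0r.
move/eqP; rewrite mulf_eq0 => /orP[/eqP p0|/eqP//]; exfalso.
move/eqP: p0; apply/negP; apply: mulf_neq0; last by rewrite invr_neq0// total_Posz.
apply: mulf_neq0; first exact: multinomial_neq0.
apply/prodf_neq0 => i _; rewrite !mxE.
by apply: sample_power_neq0 => j jk; rewrite /= mulr1 eqr_nat gtn_eqF.
Qed.

(** Uniqueness of base-[B] digits: reduction modulo [B] recovers the lowest digit, and the quotient
    is left to the induction. *)
Lemma positional_inj {r B : nat} (f g : 'I_r -> nat) :
  (forall i, f i < B)%N -> (forall i, g i < B)%N ->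
  (\sum_i f i * B ^ i = \sum_i g i * B ^ i)%N -> f =1 g.
Proof.
elim: r f g => [|r IHr] f g fB gB; first by move=> _ [[]].
have recl (h : 'I_r.+1 -> nat) :
    (\sum_i h i * B ^ i = (\sum_(i < r) h (lift ord0 i) * B ^ i) * B + h ord0)%N.
  rewrite big_ord_recl expn0 muln1 addnC big_distrl; congr (_ + _)%N.
  by apply: eq_bigr => i _; rewrite lift0 expnSr mulnA.
rewrite !recl => fg.
have B0 : (0 < B)%N by apply: leq_ltn_trans (fB ord0).
have fg0 : f ord0 = g ord0.
  by have := congr1 (modn^~ B) fg; rewrite !modnMDl !modn_small.
move: fg; rewrite fg0 => /addIn/eqP; rewrite eqn_pmul2r// => /eqP fgS i.
case: (unliftP ord0 i) => [j|] ->; last exact: fg0.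
exact: (IHr (f \o lift ord0) (g \o lift ord0) (fun=> fB _) (fun=> gB _) fgS j).
Qed.

(* Kronecker substitution: x0_i = N ^ ((m + 1) ^ i) turns the hypothesis into the
   vanishing at all N >= 1 of a univariate polynomial in which distinct k have
   distinct exponents. *)
Lemma with_replacement_mean_eq0 {R : realType} {r m : nat}
    (b : Delta r m -> R) : (0 < r)%N -> (0 < m)%N ->
  (forall x0, admissible m with_replacement x0 ->
     \sum_k sample_prob R with_replacement (map_mx Posz x0) k * b k = 0) ->
  forall k, b k = 0.
Proof.
move=> r0 m0 b0 k.
pose e (l : Delta r m) := (\sum_i cnt l i * m.+1 ^ i)%N.
have e_inj : injective e.
  move=> l l' /positional_inj ll'; apply/cnt_inj/ll' => i; exact: ltn_ord.
pose p : {poly R} := \sum_l (multinomial R l * b l) *: 'X^(e l).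
have p_root N : root p N.+1%:R.
  pose x0 : 'rV[nat]_r := \row_(i < r) (N.+1 ^ (m.+1 ^ i))%N.
  have adm : admissible m with_replacement x0.
    rewrite /= /initial_total (bigD1 (Ordinal r0))//= mxE.
    by rewrite (leq_trans _ (leq_addr _ _))// expn_gt0.
  have [_ Tm] := @admissible_total_neq0 R _ _ _ _ _ m0 adm (leqnn _).
  (* Dividing by the nonzero denominator turns the value of [p] at [N.+1] into the mean of [b]. *)
  apply/rootP; apply: (mulIf (invr_neq0 Tm)); rewrite mul0r -[RHS](b0 _ adm).
  rewrite /p horner_sum mulr_suml; apply: eq_bigr => l _.
  rewrite hornerZ hornerXn /sample_prob total_Posz /=.
  rewrite [X in _ = _ * X / _ * _](_ : _ = N.+1%:R ^+ e l); first by ring.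
  rewrite /e (big_morph _ (exprD N.+1%:R) (expr0 N.+1%:R)); apply: eq_bigr => i _.
  by rewrite !mxE -pmulrn natrX -exprM mulnC.
have p0 : p = 0.
  (* The points [N.+1] with [N < size p] are [size p] distinct roots, more than the degree
     allows. *)
  apply: (@roots_geq_poly_eq0 _ _ [seq N.+1%:R | N <- iota 0 (size p)]).
  - by apply/allP => _ /mapP[N _ ->].
  - rewrite map_inj_uniq ?iota_uniq// => N N' /eqP.
    by rewrite eqr_nat eqSS => /eqP.
  - by rewrite size_map size_iota.
have := congr1 (fun q : {poly R} => q`_(e k)) p0.
rewrite coef0 coef_sum (bigD1 k)//= big1 ?addr0; last first.
  by move=> l lk; rewrite coefZ coefXn (inj_eq e_inj) eq_sym (negbTE lk) mulr0.
rewrite coefZ coefXn eqxx mulr1 => /eqP.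
by rewrite mulf_eq0 (negbTE (multinomial_neq0 k)) => /eqP.
Qed.

Lemma mean_eq0 {R : realType} {r m : nat} s (b : Delta r m -> 'rV[R]_r) :
  (0 < r)%N -> (0 < m)%N ->
  (forall x0, admissible m s x0 ->
     \sum_k sample_prob R s (map_mx Posz x0) k *: b k = 0) ->
  forall k, b k = 0.
Proof.
move=> r0 m0 b0 k; apply/rowP => j; rewrite mxE.
have {}b0 x0 : admissible m s x0 ->
    \sum_k sample_prob R s (map_mx Posz x0) k * b k 0 j = 0.
  move=> /b0/rowP/(_ j); rewrite summxE [RHS]mxE => b0j; rewrite -[RHS]b0j.
  by apply: eq_bigr => l _; rewrite mxE.
case: s b0 => b0.
  exact: (without_replacement_mean_eq0 (fun k => b k 0 j)).
exact: (with_replacement_mean_eq0 (fun k => b k 0 j)).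
Qed.

(** Any other [k] asks for a ball of a color absent from the urn, and the factor of that color
    vanishes. *)
Lemma sample_prob_monochrome {R : realType} {r m : nat} s (t : nat) (i : 'I_r)
    (k : Delta r m) : k != vertex m i ->
  sample_prob R s (map_mx Posz (\row_j if j == i then t else 0%N)) k = 0.
Proof.
move=> /exists_cnt_gt[j]; rewrite {1}/cnt /= ffunE.
(* The case [j = i] would require more than [m] balls of color [i]. *)
case: ifPn => [_|ji kj]; first by rewrite ltnNge -ltnS ltn_ord.
rewrite /sample_prob (bigD1 j)//= !mxE (negbTE ji).
by case: (cnt k j) kj => // e _; rewrite sample_powerSl !mul0r mulr0 mul0r.
Qed.

(** * Equivalence of linearity and the affine rule *)

Section linearity.
Context {R : realType} {r m : nat} (s : sampling) (a : Delta r m -> 'rV[int]_r).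
Context (r0 : (0 < r)%N) (m0 : (0 < m)%N).
Context (U : forall x0 : 'rV[nat]_r, admissible m s x0 -> urn_process R s a x0).

(** Before the first draw nothing is random: the linear form and the sampling mean are both constant
    versions of the same conditional expectation, and integrating over the whole space identifies
    them. *)
Lemma linear_urn_drift : linear_urn U ->
  forall t : nat, exists B : 'M[R]_r, forall x0, admissible m s x0 ->
    initial_total x0 = t ->
    \sum_k sample_prob R s (map_mx Posz x0) k *: real_row R a k =
    map_mx intr (map_mx Posz x0) *m B.
Proof.
move=> lin t; have [C linC] := lin t; exists (C 1%N - 1%:M) => x0 adm x0t.
set x : 'rV[R]_r := map_mx _ _.
rewrite mulmxBr mulmx1; apply/eqP; rewrite eq_sym subr_eq eq_sym addrC; apply/eqP.
apply/rowP => j.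
have FT : urnF (U x0 adm) 0 setT.
  exact: (@draw_algebra_composition _ _ _ a x0 _ 0 setT).
have [_ _ _ /(_ _ FT) linE] := linC x0 adm x0t 1%N isT j.
have [_ _ _ /(_ _ FT)] := urn_condexp (U x0 adm) 0 j.
have cstE (c : R) : (\int[urn_law (U x0 adm)]_w c%:E = c%:E)%E.
  by rewrite (integral_cst _ measurableT) [X in (_ * X)%E]probability_setT mule1.
rewrite -linE => E; apply: EFin_inj.
rewrite -[LHS]cstE; exact: etrans E (cstE ((x *m C 1%N) 0 j)).
Qed.

Lemma linear_affine_rule : linear_urn U -> affine_rule R a.
Proof.
move=> /linear_urn_drift drift.
suff dev0 k : real_row R a k - affine_interpolant a k = 0.
  by move=> k; apply/eqP; rewrite -subr_eq0; exact/eqP/dev0.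
move: k; apply: (@mean_eq0 _ _ _ s) => // x0 adm.
have [T0 Tm] := @admissible_total_neq0 R _ _ _ _ _ m0 adm (leqnn _).
have [B driftB] := drift (initial_total x0).
(* A one-color urn with the same total can only yield [vertex m i], which identifies row [i] of
   [B]. *)
have vertexE i : real_row R a (vertex m i) = (initial_total x0)%:R *: row i B.
  pose y : 'rV[nat]_r := \row_j if j == i then initial_total x0 else 0%N.
  have yt : initial_total y = initial_total x0.
    rewrite /initial_total (bigD1 i)//= mxE eqxx big1 ?addn0// => j /negbTE ji.
    by rewrite mxE ji.
  have yE : map_mx intr (map_mx Posz y) =
      (initial_total x0)%:R *: delta_mx 0 i :> 'rV[R]_r.
    apply/rowP => j; rewrite !mxE eqxx/=.
    by case: eqP => _; rewrite ?mulr1 ?mulr0.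
  have admy : admissible m s y by case: (s) adm; rewrite /admissible yt.
  have := @affine_interpolant_mean R _ _ a s (map_mx Posz y) m0.
  rewrite total_Posz yt => /(_ T0 Tm).
  rewrite yE -scalemxAl scalerA mulVf// scale1r -rowE rowK => <-.
  (* Only [vertex m i] has nonzero probability at [y], and there the rule and its interpolant
     agree. *)
  rewrite rowE scalemxAl -yE -driftB//; apply: eq_bigr => k _.
  have [->|ki] := eqVneq k (vertex m i); first by rewrite affine_interpolant_vertex.
  by rewrite sample_prob_monochrome// !scale0r.
have AE : reduced_matrix R a = (initial_total x0)%:R *: B.
  by apply/row_matrixP => i; rewrite rowK vertexE linearZ.
under eq_bigr => k _ do rewrite scalerBr.
(* Both means are the image of [x0] under [B]: that of the rule by [driftB], that of the interpolant
   by [AE]. *)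
rewrite sumrB driftB// affine_interpolant_mean ?total_Posz//.
by rewrite AE -scalemxAr scalerA mulVf// scale1r subrr.
Qed.

Context {sigma : int} (sigma0 : 0 < sigma) (bal : balanced a sigma).

(** The total is cast from a natural number so that [admissible_total_neq0] applies to it;
    positivity identifies [sigma] with its absolute value. *)
Lemma urnTE {x0} (adm : admissible m s x0) n w :
  urnT (U x0 adm) n w = (initial_total x0 + `|sigma| * n)%:R.
Proof.
rewrite [LHS](_ : _ = (Defs.total
    (composition a x0 (@urn_draw _ _ _ _ _ _ (U x0 adm)) n w))%:~R); last first.
  by rewrite /Defs.total rmorph_sum; apply: eq_bigr => i _; rewrite mxE.
rewrite (total_composition _ _ _ _ bal) [RHS]pmulrn; congr (_%:~R).
by rewrite PoszD PoszM gtz0_abs// -mulrzz.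
Qed.

(** Under the affine rule the drift in [urn_condexp] is the mean of the interpolant at the current
    composition. *)
Lemma affine_rule_condexp {x0} (adm : admissible m s x0) n : affine_rule R a ->
  is_condexp_row (urn_law (U x0 adm)) (urnF (U x0 adm) n)
    (urnX (U x0 adm) n.+1)
    (fun w => urnX (U x0 adm) n w *m
       (1%:M + (urnT (U x0 adm) n w)^-1 *: reduced_matrix R a)).
Proof.
move=> aff; rewrite (_ : (fun w => _) = (fun w => urnX (U x0 adm) n w +
    \sum_k sample_prob R s
      (composition a x0 (@urn_draw _ _ _ _ _ _ (U x0 adm)) n w) k *:
      real_row R a k)); first exact: urn_condexp.
apply/funext => w; rewrite mulmxDr mulmx1 -scalemxAr; congr (_ + _).
under [RHS]eq_bigr => k _ do rewrite aff.
have [T0 Tm] := @admissible_total_neq0 R _ _ _ _ _ m0 adm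
  (leq_addr (`|sigma| * n) _).
have TE : (Defs.total
    (composition a x0 (@urn_draw _ _ _ _ _ _ (U x0 adm)) n w))%:~R =
    (initial_total x0 + `|sigma| * n)%:R :> R.
  rewrite -(urnTE adm n w) /Defs.total rmorph_sum.
  by apply: eq_bigr => i _; rewrite mxE.
by rewrite affine_interpolant_mean ?TE// urnTE.
Qed.

Lemma affine_rule_linear : affine_rule R a -> linear_urn U.
Proof.
move=> aff t.
(* The [n]-th draw is made from the total after [n.-1] draws, which depends on [x0] only through
   [t]. *)
exists (fun n => 1%:M + (t + `|sigma| * n.-1)%:R^-1 *: reduced_matrix R a).
move=> x0 adm <- [//|n] _ /=.
have := affine_rule_condexp adm n aff.
by under eq_fun do rewrite urnTE.
Qed.

End linearity.

Theorem theorem1 (R : realType) (r m : nat) (hr : (2 <= r)%N) (hm : (1 <= m)%N)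
    (s : sampling) (a : Delta r m -> 'rV[int]_r) (sigma : int)
    (hsigma : 0 < sigma) (hbal : balanced a sigma) (hten : tenable s a)
    (U : forall x0 : 'rV[nat]_r, admissible m s x0 -> urn_process R s a x0) :
  (linear_urn U <-> affine_rule R a) /\
  (linear_urn U ->
   forall (x0 : 'rV[nat]_r) (hx0 : admissible m s x0) (n : nat), (1 <= n)%N ->
     is_condexp_row (urn_law (U x0 hx0)) (urnF (U x0 hx0) n.-1)
       (urnX (U x0 hx0) n)
       (fun w => urnX (U x0 hx0) n.-1 w *m
          (1%:M + (urnT (U x0 hx0) n.-1 w)^-1 *: reduced_matrix R a))).
Proof.
have r0 : (0 < r)%N by exact: ltnW.
split; last first.
  move=> /(linear_affine_rule _ _ r0 hm) aff x0 adm [//|n] _.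
  exact: (affine_rule_condexp _ _ hm _ hsigma hbal).
split; first exact: linear_affine_rule.
exact: (affine_rule_linear _ _ hm _ hsigma hbal).
Qed.
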